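(* Let $m$ and $n$ be positive integers, and let $p$ be a prime. Define \[T(x):=\Phi_{p^m}\left(\Phi_{2^n}(x)\right),\] where $\Phi_k(x)$ is the cyclotomic polynomial of index $k$. Then $T(x)$ is irreducible over $\mathbb{Q}$ and monogenic.
   Context: $\Phi_k(x)\in\mathbb{Z}[x]$ denotes the cyclotomic polynomial of index $k$, i.e. the minimal polynomial over $\mathbb{Q}$ of a primitive $k$th root of unity. A monic polynomial $f(x)\in\mathbb{Z}[x]$ is called monogenic if $f(x)$ is irreducible over $\mathbb{Q}$ and, for $\theta$ a root of $f(x)$ and $K=\mathbb{Q}(\theta)$ with ring of integers $\mathbb{Z}_K$, one has $[\mathbb{Z}_K:\mathbb{Z}[\theta]]=1$; equivalently, $\{1,\theta,\theta^2,\ldots,\theta^{\deg(f)-1}\}$ is a $\mathbb{Z}$-basis of $\mathbb{Z}_K$. *)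

(* Defs.v *)
From HB Require Import structures.
From mathcomp Require Import all_boot all_order all_algebra all_field.

Set Implicit Arguments.
Unset Strict Implicit.
Unset Printing Implicit Defensive.

Import Order.TTheory GRing.Theory Num.Theory.
Local Open Scope ring_scope.

Definition irreducible_over_rat (f : {poly int}) : Prop :=
  irreducible_poly (map_poly (intr : int -> rat) f).

(* Z[theta] *)
Definition int_adjoin (theta x : algC) : Prop :=
  exists g : {poly int}, x = (map_poly intr g).[theta].

(* Q(theta), as the field of all fractions g(theta) / h(theta) *)
Definition rat_adjoin (theta x : algC) : Prop :=
  exists g h : {poly rat},
    (map_poly ratr h).[theta] != 0 /\
    x = (map_poly ratr g).[theta] / (map_poly ratr h).[theta].

Definition ring_of_integers (K : algC -> Prop) (x : algC) : Prop :=
  K x /\ x \in Aint.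

(* [A : B] = k for additive subgroups B <= A of V: the r i are a complete
   and irredundant system of representatives of A / B. *)
Definition has_index (V : zmodType) (A B : V -> Prop) (k : nat) : Prop :=
  (forall x, B x -> A x) /\
  exists r : 'I_k -> V,
    (forall i, A (r i)) /\
    (forall x, A x -> exists! i, B (x - r i)).

Definition monogenic (f : {poly int}) : Prop :=
  [/\ f \is monic,
      irreducible_over_rat f
    & forall theta : algC, root (map_poly intr f) theta ->
        has_index (ring_of_integers (rat_adjoin theta)) (int_adjoin theta) 1].

(* Main.v *)
(** Put [N = 2 ^ (n - 1)], so that a root [theta] of [T] satisfies
    [theta ^ N = zeta - 1] with [zeta] a primitive [p ^ m]-th root of unity. Modulo
    [p], [T] is a power of ['X], and [T(0) = Phi_{p^m}(1) = p], so [T] is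
    Eisenstein: it is irreducible and [p] does not divide the index. Differences of
    roots of [T] divide [p ^ (m + 1) * N], so only [p] and [2] can divide the index.
    For [p] odd and [N] even, choose a power [eta] of [zeta] with [eta ^ N = zeta] and
    shift to [pi = theta - (eta - 1)]. Over [Z[zeta]], which is the ring of integers
    of its fraction field by the case [N = 1], the equation of [pi] is Eisenstein at
    every prime above [2], because its constant term
    [(eta - 1) ^ N - (eta ^ N - 1)] is [2 (1 + eta ^ (N / 2))] modulo [4] and
    [1 + eta ^ (N / 2)] is a cyclotomic unit. *)

Require Import Defs.
From HB Require Import structures.
From mathcomp Require Import all_boot all_order all_algebra all_field.
From mathcomp Require Import cyclic ring.

Set Implicit Arguments.
Unset Strict Implicit.
Unset Printing Implicit Defensive.

Import Order.TTheory GRing.Theory Num.Theory.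
Local Open Scope ring_scope.

(** * Cyclotomic polynomials of prime power index *)

Lemma mul_Cyclotomic_pfactor (p k : nat) : prime p ->
  'Phi_(p ^ k.+1) * ('X^(p ^ k) - 1) = 'X^(p ^ k.+1) - 1.
Proof.
move=> p_pr; have p_gt0 := prime_gt0 p_pr.
rewrite -!prod_Cyclotomic ?expn_gt0 ?p_gt0 //.
suff /(perm_big _)-> :
    perm_eq (divisors (p ^ k.+1)) ((p ^ k.+1)%N :: divisors (p ^ k)).
  by rewrite big_cons.
apply: uniq_perm; rewrite /= ?divisors_uniq ?andbT //.
  by rewrite -dvdn_divisors ?expn_gt0 ?p_gt0 // dvdn_Pexp2l ?prime_gt1 // ltnn.
move=> d; rewrite inE -!dvdn_divisors ?expn_gt0 ?p_gt0 //.
apply/idP/orP => [/(dvdn_pfactor _ _ p_pr)[i]|[/eqP-> //|/dvdn_trans->//]].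
  rewrite leq_eqVlt => /orP[/eqP-> ->|]; first by left.
  by rewrite ltnS => le_ik ->; right; rewrite dvdn_exp2l.
by rewrite dvdn_exp2l.
Qed.

Lemma Cyclotomic_pfactor (p k : nat) : prime p ->
  'Phi_(p ^ k.+1) = \sum_(i < p) 'X^(p ^ k * i).
Proof.
move=> p_pr; have pk_gt0 : (0 < p ^ k)%N by rewrite expn_gt0 prime_gt0.
apply: (mulIf (monic_neq0 (monicXnsubC (1 : int) pk_gt0))).
rewrite mul_Cyclotomic_pfactor // expnSr exprM subrX1 mulrC.
by congr (_ * _); apply: eq_bigr => i _; rewrite exprM.
Qed.

Lemma Cyclotomic_pfactor_at1 (p k : nat) : prime p -> ('Phi_(p ^ k.+1)).[1] = p%:Z.
Proof.
move=> p_pr; rewrite Cyclotomic_pfactor // horner_sum.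
under eq_bigr do rewrite hornerXn expr1n.
by rewrite sumr_const card_ord natz.
Qed.

Lemma Cyclotomic_pow2 (k : nat) : 'Phi_(2 ^ k.+1) = 'X^(2 ^ k) + 1.
Proof.
by rewrite Cyclotomic_pfactor // !big_ord_recr big_ord0 /= add0r muln0 muln1 expr0 addrC.
Qed.

(** * The Eisenstein shape of [T] at [p] *)

Section CompositeXn.

Variables (p k N : nat).
Hypotheses (p_pr : prime p) (N_gt0 : (0 < N)%N).

Let T : {poly int} := 'Phi_(p ^ k.+1) \Po ('X^N + 1).

Lemma Cyclotomic_compXn_monic : T \is monic.
Proof.
rewrite monicE lead_coef_comp ?size_XnaddC //.
by rewrite (monicP (Cyclotomic_monic _)) lead_coefXnaddC // expr1n mulr1.
Qed.

Lemma size_Cyclotomic_compXn : size T = (totient (p ^ k.+1) * N).+1.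
Proof.
rewrite polySpred ?monic_neq0 ?Cyclotomic_compXn_monic //.
by rewrite size_comp_poly size_Cyclotomic size_XnaddC.
Qed.

Lemma Cyclotomic_compXn_at0 : T.[0] = p%:Z.
Proof. by rewrite horner_comp !hornerE expr0n gtn_eqF // add0r Cyclotomic_pfactor_at1. Qed.

(** With [Y = 'X^N + 1], Frobenius turns [Y ^+ (p ^ i) - 1] into ['X^(N * p ^ i)]. The factorization
    of ['X^(p ^ k.+1) - 1] evaluated at [Y] then leaves a power of ['X] after cancellation. *)
Lemma Cyclotomic_compXn_modp :
  map_poly (intr : int -> 'F_p) T = 'X^(totient (p ^ k.+1) * N).
Proof.
have pX i : [pchar {poly 'F_p}].-nat (p ^ i)%N.
  have /(pcharf_eq)/eq_pnat-> : p \in [pchar {poly 'F_p}].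
    by rewrite pchar_poly pchar_Fp.
  by rewrite pnatX pnat_id.
have XN1 : map_poly intr ('X^N + 1) = 'X^N + 1 :> {poly 'F_p}.
  by rewrite rmorphD rmorph1 /= map_polyXn.
have nz : 'X^N ^+ (p ^ k) != 0 :> {poly 'F_p} by rewrite !expf_neq0 ?polyX_eq0.
apply: (mulIf nz).
have /(congr1 (fun f => map_poly (intr : int -> 'F_p) f \Po ('X^N + 1))) :=
  mul_Cyclotomic_pfactor k p_pr.
rewrite !(rmorphM, rmorphB, rmorph1) /= !map_polyXn !comp_Xn_poly.
rewrite !exprDn_pchar ?pX // !expr1n !addrK.
rewrite /T map_comp_poly XN1 => ->.
rewrite -!exprM -exprD; congr 'X^_.
rewrite totient_pfactor // [X in (X + _)%N]mulnC -mulnDr; congr (_ * _)%N.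
by rewrite addnC -mulSn prednK ?prime_gt0 // expnS.
Qed.

(** Lifts the congruence modulo [p] to the integers, so that at a root it reads
    [theta ^+ D = p%:R * u] with [u] in [Z[theta]]. *)
Lemma Cyclotomic_compXn_Eisenstein :
  exists U : {poly int}, T = 'X^(totient (p ^ k.+1) * N) + p%:R * U.
Proof.
set D := (_ * N)%N.
have dvdT i : (p %| (T - 'X^D)`_i)%Z.
  rewrite (dvdz_pcharf (pchar_Fp p_pr)) -(coef_map (intr : int -> 'F_p)).
  by rewrite rmorphB /= Cyclotomic_compXn_modp map_polyXn subrr coef0.
exists (\poly_(i < size (T - 'X^D)) ((T - 'X^D)`_i %/ p)%Z).
apply/eqP; rewrite addrC -subr_eq; apply/eqP/polyP=> i; rewrite mulr_natl coefMn coef_poly.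
case: ltnP => [_|/(nth_default 0)->]; last by rewrite mul0rn.
by rewrite -mulr_natr natz divzK.
Qed.

Lemma Cyclotomic_compXn_irreducible : irreducible_over_rat T.
Proof.
have D_gt0 : (0 < totient (p ^ k.+1) * N)%N.
  by rewrite muln_gt0 totient_gt0 expn_gt0 prime_gt0.
apply/irreducible_rat_int/(eisenstein_crit p_pr).
- by rewrite size_Cyclotomic_compXn eqSS -lt0n.
- by rewrite (monicP Cyclotomic_compXn_monic) dvdz1 gtn_eqF ?prime_gt1.
- rewrite -horner_coef0 Cyclotomic_compXn_at0 dvdzE /=.
  (* [p ^+ 2] is the power of [nat] as a semiring. *)
  change (~~ (p ^ 2 %| p)%N).
  by rewrite gtnNdvd ?prime_gt0 // -mulnn ltn_Pmull ?prime_gt1 ?prime_gt0.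
move=> i; rewrite size_Cyclotomic_compXn /= => lt_iD.
rewrite (dvdz_pcharf (pchar_Fp p_pr)) -(coef_map (intr : int -> 'F_p)).
by rewrite Cyclotomic_compXn_modp coefXn ltn_eqF.
Qed.

End CompositeXn.

(** * Closure properties of [Z[theta]], and algebraic integers *)

Lemma int_adjoin_int (theta : algC) (c : int) : int_adjoin theta c%:~R.
Proof. by exists c%:P; rewrite map_polyC hornerC. Qed.

Lemma int_adjoin_nat (theta : algC) (n : nat) : int_adjoin theta n%:R.
Proof. by have := int_adjoin_int theta n. Qed.

Lemma int_adjoin_gen (theta : algC) : int_adjoin theta theta.
Proof. by exists 'X; rewrite map_polyX hornerX. Qed.

Lemma int_adjoinD (theta x y : algC) :
  int_adjoin theta x -> int_adjoin theta y -> int_adjoin theta (x + y).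
Proof. by move=> [f ->] [g ->]; exists (f + g); rewrite rmorphD hornerD. Qed.

Lemma int_adjoinN (theta x : algC) : int_adjoin theta x -> int_adjoin theta (- x).
Proof. by move=> [f ->]; exists (- f); rewrite rmorphN hornerN. Qed.

Lemma int_adjoinB (theta x y : algC) :
  int_adjoin theta x -> int_adjoin theta y -> int_adjoin theta (x - y).
Proof. by move=> Rx Ry; apply/int_adjoinD/int_adjoinN. Qed.

Lemma int_adjoinM (theta x y : algC) :
  int_adjoin theta x -> int_adjoin theta y -> int_adjoin theta (x * y).
Proof. by move=> [f ->] [g ->]; exists (f * g); rewrite rmorphM hornerM. Qed.

Lemma int_adjoinX (theta x : algC) (n : nat) :
  int_adjoin theta x -> int_adjoin theta (x ^+ n).
Proof. by move=> [f ->]; exists (f ^+ n); rewrite rmorphXn /= horner_exp. Qed.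

Lemma int_adjoin_trans (theta x y : algC) :
  int_adjoin theta x -> int_adjoin x y -> int_adjoin theta y.
Proof.
by move=> [f ->] [g ->]; exists (g \Po f); rewrite map_comp_poly horner_comp.
Qed.

Lemma int_adjoin_Aint (theta x : algC) :
  theta \in Aint -> int_adjoin theta x -> x \in Aint.
Proof.
move=> Atheta [f ->]; apply: rpred_horner => //.
by apply/polyOverP=> i; rewrite coef_map Aint_int.
Qed.

Lemma Aint_root_int (f : {poly int}) (theta : algC) :
  f \is monic -> root (map_poly intr f) theta -> theta \in Aint.
Proof.
move=> f_monic /root_monic_Aint; apply; first by rewrite monic_map.
by apply/polyOverP=> i; rewrite coef_map rpred_int.
Qed.

Lemma dvdz_Aint (p c : int) : p != 0 -> (c%:~R / p%:~R : algC) \in Aint -> (p %| c)%Z.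
Proof.
move=> p_nz /Cint_rat_Aint; rewrite rpred_div ?rpred_int // => /(_ isT)/intrP[n].
move/(canRL (divfK _)); rewrite intr_eq0 => /(_ p_nz); rewrite -intrM => /intr_inj->.
exact: dvdz_mull.
Qed.

(** Reduction modulo [theta - b]. It serves with [b = 0] for the descent at [p], and with
    [b = eta - 1] for the descent at 2. *)
Lemma int_adjoin_hornerB (theta b : algC) (g : {poly int}) : int_adjoin theta b ->
  exists2 r, int_adjoin theta r &
    (map_poly intr g).[theta] = (map_poly intr g).[b] + (theta - b) * r.
Proof.
move=> Rb; elim/poly_ind: g => [|g c [r Rr Dr]].
  by exists 0; rewrite ?rmorph0 ?horner0 ?mulr0 ?addr0 //; apply: (int_adjoin_int theta 0).
exists ((map_poly intr g).[b] + r * theta).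
  apply: int_adjoinD; last by apply: int_adjoinM => //; apply: int_adjoin_gen.
  by apply: int_adjoin_trans Rb _; exists g.
rewrite rmorphD rmorphM /= map_polyX map_polyC !hornerMXaddC Dr; ring.
Qed.

(** * Descent at [p]: an Eisenstein root gives an index prime to [p] *)

Section Eisenstein.

Variables (p D : nat) (U : {poly int}) (theta : algC).
Let f := 'X^D + p%:R * U.
Hypotheses (p_pr : prime p) (D_gt0 : (0 < D)%N) (f_monic : f \is monic) (f0 : f.[0] = p%:Z).
Hypothesis (f_theta : root (map_poly intr f) theta).

Let u := - (map_poly intr U).[theta].

Let Ru : int_adjoin theta u.
Proof. by apply: int_adjoinN; exists U. Qed.

Let thetaD : theta ^+ D = p%:R * u.
Proof.
apply/eqP; move: f_theta; rewrite /root rmorphD rmorphM /= map_polyXn rmorph_nat !hornerE.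
by rewrite -polyC_natr hornerC addr_eq0 -mulrN.
Qed.

Let theta_Aint : theta \in Aint. Proof. exact: Aint_root_int f_theta. Qed.

Let p_neq0 : p%:R != 0 :> algC.
Proof. by rewrite pnatr_eq0 -lt0n prime_gt0. Qed.

(** Reducing [f] modulo [theta] turns [f(theta) = 0] into [f(0) = p] being a multiple of [theta]. *)
Lemma Eisenstein_root_dvd_prime : exists2 w, int_adjoin theta w & p%:R = theta * w.
Proof.
have [r Rr] := int_adjoin_hornerB f (int_adjoin_int theta 0).
rewrite (rootP f_theta) horner_map f0 subr0 => /esym/eqP.
rewrite addr_eq0 => /eqP Dp; exists (- r); first exact: int_adjoinN.
by rewrite mulrN -Dp.
Qed.

Lemma Eisenstein_root_neq0 : theta != 0.
Proof.
have [w _ Dp] := Eisenstein_root_dvd_prime.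
by apply: contraNneq p_neq0 => theta0; rewrite Dp theta0 mul0r.
Qed.

Let Eisenstein_descent1 (x : algC) :
  x \in Aint -> int_adjoin theta (theta * x) -> int_adjoin theta x.
Proof.
move=> Ax [g Dg]; have [r Rr] := int_adjoin_hornerB g (int_adjoin_int theta 0).
rewrite -Dg horner_map subr0; set c := g.[0] => Dx.
have Dc : theta * (x - r) = c%:~R by rewrite mulrBr Dx addrK.
(* Since [c = theta * (x - r)], the quotient [c ^+ D / p] is [u * (x - r) ^+ D], a rational
   algebraic integer. *)
have: (p %| c ^+ D)%Z.
  apply: dvdz_Aint; first by rewrite -lt0n prime_gt0.
  rewrite rmorphXn /= -Dc exprMn thetaD -[p%:~R]/p%:R -(mulrA p%:R) mulrAC divff // mul1r.
  apply: rpredM; first exact: int_adjoin_Aint Ru.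
  by rewrite rpredX // rpredB //; apply: int_adjoin_Aint Rr.
rewrite dvdzE abszX Euclid_dvdX // D_gt0 andbT.
have -> : (p %| `|c|%N)%N = (p %| c)%Z by rewrite dvdzE.
(* As [p = theta * w], the constant [c = c1 * p] is itself a multiple of [theta] in [Z[theta]], and
   [theta] cancels. *)
case/dvdzP=> c1 Dc1; have [w Rw Dp] := Eisenstein_root_dvd_prime.
have -> : x = r + c1%:~R * w.
  apply: (mulfI Eisenstein_root_neq0); rewrite mulrDr mulrCA -Dp.
  by rewrite Dx Dc1 rmorphM /= addrC.
by apply: int_adjoinD => //; apply: int_adjoinM => //; apply: int_adjoin_int.
Qed.

(** A factor [p] is traded for [theta ^+ D = p%:R * u], whose factors [theta] are then removed one
    at a time. *)
Lemma Eisenstein_descent (x : algC) (a : nat) :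
  x \in Aint -> int_adjoin theta ((p ^ a)%:R * x) -> int_adjoin theta x.
Proof.
have descent_exp i y : y \in Aint -> int_adjoin theta (theta ^+ i * y) -> int_adjoin theta y.
  elim: i => [|i IHi] Ay; first by rewrite mul1r.
  rewrite exprS -mulrA => /Eisenstein_descent1 Ry; apply/IHi/Ry => //.
  by rewrite rpredM ?rpredX.
move=> Ax; elim: a => [|a IHa]; first by rewrite mul1r.
rewrite expnS natrM -mulrA => Rx; apply/IHa/(@descent_exp D).
  by rewrite rpredM ?rpred_nat.
by rewrite thetaD mulrAC mulrC; apply: int_adjoinM.
Qed.

End Eisenstein.

(** * Denominators of integers, bounded by differences of conjugates *)

(* Newton interpolation: each divided difference costs one factor [d]. *)
Lemma Aint_interpolation (d : algC) (s : seq algC) (g : {poly algC}) :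
    uniq s -> (size g <= size s)%N -> {subset s <= Aint} -> d \in Aint ->
    {in s &, forall x y, x != y -> d / (x - y) \in Aint} ->
    {in s, forall x, g.[x] \in Aint} ->
  d ^+ size s *: g \is a polyOver Aint.
Proof.
move=> + + + Ad; elim: s g => [|x s IHs] g.
  by rewrite /= leqn0 size_poly_eq0 => _ /eqP-> _ _ _; rewrite scaler0 rpred0.
case/andP=> s'x uniq_s sz_g As dP gP.
have xs : x \in x :: s by rewrite inE eqxx.
have ss y : y \in s -> y \in x :: s by rewrite inE orbC => ->.
have /factor_theorem[q Dq] : root (g - (g.[x])%:P) x.
  by rewrite /root hornerD hornerN hornerC subrr.
have Dg : g = q * ('X - x%:P) + (g.[x])%:P by rewrite -Dq subrK.
(* The quotient [q] is the divided difference of [g] at [x]; scaling by [d] makes its values on [s]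
   integral, as the induction requires. *)
have Aq y : y \in s -> (d *: q).[y] \in Aint.
  move=> sy; have y'x : y != x by apply: contraNneq s'x => <-.
  have yx_neq0 : y - x != 0 by rewrite subr_eq0.
  have -> : (d *: q).[y] = d / (y - x) * (g.[y] - g.[x]).
    rewrite {1}Dg hornerD hornerM hornerXsubC hornerC addrK hornerZ.
    by rewrite [q.[y] * _]mulrC mulrA divfK.
  apply: rpredM; first by apply: dP => //; apply: ss.
  by apply: rpredB; apply: gP => //; apply: ss.
have szq : (size (d *: q) <= size s)%N.
  apply: leq_trans (size_scale_leq _ _) _.
  have [->|q_neq0] := eqVneq q 0; first by rewrite size_poly0.
  rewrite -ltnS; apply: leq_trans sz_g.
  have <- : size (g - (g.[x])%:P) = (size q).+1.
    by rewrite Dq size_Mmonic ?monicXsubC // size_XsubC addn2.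
  apply: leq_trans (size_polyD _ _) _; rewrite size_polyN geq_max leqnn.
  apply: leq_trans (size_polyC_leq1 _) _.
  rewrite lt0n size_poly_eq0; apply: contraNneq q_neq0 => g0.
  by move/eqP: Dq; rewrite g0 horner0 subr0 eq_sym mulf_eq0 polyXsubC_eq0 orbF.
have : d ^+ size s *: (d *: q) \is a polyOver Aint.
  apply: IHs => // [y /ss/As //|y z sy sz]; exact: (dP _ _ (ss _ sy) (ss _ sz)).
rewrite scalerA -exprSr => qP.
rewrite [g]Dg scalerDr scalerAl rpredD //.
  by rewrite rpredM // polyOverXsubC As.
by rewrite -mul_polyC -polyCM polyOverC rpredM ?rpredX ?gP.
Qed.

Section Separable.

Variables (f : {poly int}) (theta : algC).
Hypotheses (f_monic : f \is monic) (f_irr : irreducible_over_rat f).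
Hypothesis (f_theta : root (map_poly intr f) theta).

Let fQ := map_poly (intr : int -> rat) f.
Let fQtoC : map_poly ratr fQ = map_poly intr f :> {poly algC}.
Proof. by rewrite -map_poly_comp; apply: eq_map_poly => a; rewrite /= ratr_int. Qed.

Lemma irreducible_root_coprime (h : {poly rat}) :
  (map_poly ratr h).[theta] != 0 -> coprimep fQ h.
Proof.
move=> h_theta; rewrite irreducible_poly_coprime //.
apply: contra h_theta => /dvdpP[q ->]; rewrite rmorphM /= hornerM fQtoC.
by rewrite (rootP f_theta) mulr0.
Qed.

Lemma irreducible_root_dvd (h : {poly rat}) :
  root (map_poly ratr h) theta -> fQ %| h.
Proof.
move=> h_theta; rewrite -[_ %| _]negbK -irreducible_poly_coprime //.
rewrite -(coprimep_map (ratr : rat -> algC)) fQtoC.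
by apply/negP=> /coprimep_root/(_ f_theta); rewrite (rootP h_theta) eqxx.
Qed.

(** The minimal polynomial [q] of [g(theta)] makes [q \Po g] vanish at [theta], hence a multiple of
    [f], so [q] also kills [g(theta')]. *)
Lemma irreducible_conjugate_Aint (g : {poly rat}) (theta' : algC) :
    root (map_poly intr f) theta' -> (map_poly ratr g).[theta] \in Aint ->
  (map_poly ratr g).[theta'] \in Aint.
Proof.
move=> f_theta' Ax; have [q [Dq q_monic] qP] := minCpolyP (map_poly ratr g).[theta].
apply: (@root_monic_Aint (map_poly ratr q)); last by rewrite -Dq.
  rewrite /root -horner_comp -map_comp_poly.
  have /irreducible_root_dvd/dvdpP[r ->] : root (map_poly ratr (q \Po g)) theta.
    by rewrite map_comp_poly /root horner_comp -/(root _ _) qP.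
  by rewrite rmorphM hornerM /= fQtoC (rootP f_theta') mulr0.
by rewrite map_monic.
Qed.

Lemma irreducible_separable : separable_poly (map_poly (intr : int -> algC) f).
Proof.
rewrite -fQtoC separable_map unlock irreducible_poly_coprime //.
have f_gt1 : (1 < size fQ)%N by case: f_irr.
have f_neq0 := irredp_neq0 f_irr.
have f'_neq0 : fQ^`() != 0; last first.
  by apply/negP=> /(dvdp_leq f'_neq0); rewrite leqNgt lt_size_deriv.
(* In characteristic 0 the top coefficient of the derivative, at index [(size fQ).-2], is a nonzero
   multiple of the leading coefficient of [fQ]. *)
apply/eqP=> /(congr1 (fun q : {poly rat} => q`_(size fQ).-2)).
rewrite coef_deriv coef0 => /eqP; rewrite mulrn_eq0 /=.
have -> : (size fQ).-2.+1 = (size fQ).-1 by case: (size fQ) f_gt1 => [|[]].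
by rewrite -/(lead_coef _) lead_coef_eq0 (negPf f_neq0).
Qed.

Lemma irreducible_seq_roots : exists s : seq algC,
  [/\ uniq s, size s = (size f).-1 & forall x, (x \in s) = root (map_poly intr f) x].
Proof.
have [s Ds] := closed_field_poly_normal (map_poly (intr : int -> algC) f).
rewrite (monicP _) ?monic_map // scale1r in Ds.
exists s; split.
- by rewrite -separable_prod_XsubC -Ds irreducible_separable.
- rewrite -(size_map_inj_poly (intr_inj : injective (intr : int -> algC)) (rmorph0 _)).
  by rewrite Ds size_prod_XsubC.
by move=> x; rewrite Ds root_prod_XsubC.
Qed.

(** A Bezout relation inverts [h] modulo [f], and the numerator is then reduced modulo [f]. *)
Lemma rat_adjoin_rem (x : algC) : rat_adjoin theta x ->
  exists2 g : {poly rat}, (size g <= (size f).-1)%N & x = (map_poly ratr g).[theta].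
Proof.
move=> [g [h [h_theta ->]]].
have /Bezout_eq1_coprimepP[[a b] /= Dab] := irreducible_root_coprime h_theta.
exists ((g * b) %% fQ).
  rewrite -ltnS prednK ?size_poly_gt0 ?monic_neq0 // -(size_rat_int_poly f).
  by rewrite ltn_modp irredp_neq0.
have /(congr1 (fun q => (map_poly ratr q).[theta])) := divp_eq (g * b) fQ.
rewrite rmorphD !rmorphM !hornerE /= fQtoC (rootP f_theta) mulr0 add0r => <-.
congr (_ * _); move/(congr1 (fun q => (map_poly ratr q).[theta])): Dab.
rewrite rmorphD !rmorphM rmorph1 !hornerE /= fQtoC (rootP f_theta) mulr0 add0r => Dbh.
by apply: (mulIf h_theta); rewrite mulVf // Dbh.
Qed.

(** Write [x = g(theta)] with [g] of degree below that of [f]. The values of [g] at all conjugates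
    are integral, so interpolation at the roots of [f] makes [d ^ n] times [g] integral; its
    coefficients are rational, hence integers. *)
Lemma ring_of_integers_denominator (d : nat) (x : algC) :
    (forall y z : algC, root (map_poly intr f) y -> root (map_poly intr f) z -> y != z ->
       d%:R / (y - z) \in Aint) ->
    ring_of_integers (rat_adjoin theta) x ->
  exists n, int_adjoin theta ((d ^ n)%:R * x).
Proof.
move=> dP [/rat_adjoin_rem[g sz_g Dx] Ax].
have [s [uniq_s sz_s sP]] := irreducible_seq_roots; exists (size s).
have /polyOverP gP : (d%:R ^+ size s) *: map_poly ratr g \is a polyOver Aint.
  apply: Aint_interpolation => //.
  - by rewrite size_map_poly sz_s.
  - by move=> y; rewrite sP => /(Aint_root_int f_monic).
  - exact: rpred_nat.
  - by move=> y z; rewrite !sP; apply: dP.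
  by move=> y; rewrite sP => f_y; apply: irreducible_conjugate_Aint => //; rewrite -Dx.
have /floorpP[h Dh] : (d%:R ^+ size s) *: map_poly ratr g \is a polyOver (Num.int : {pred algC}).
  apply/polyOverP=> i; apply: Cint_rat_Aint => //; rewrite coefZ coef_map /=.
  by rewrite rpredM ?rpredX ?rpred_nat ?Crat_rat.
by exists h; rewrite -Dh hornerZ -Dx natrX.
Qed.

End Separable.

(** * Differences of roots of [T] *)

Lemma Aint_nat_div_1Bunity (n : nat) (w : algC) :
  w ^+ n = 1 -> w != 1 -> n%:R / (1 - w) \in Aint.
Proof.
move=> wn1 w1; have w1' : 1 - w != 0 by rewrite subr_eq0 eq_sym.
have [->|n_gt0] := posnP n; first by rewrite mul0r rpred0.
have Aw : w \in Aint by apply: (@Aint_unity_root n); rewrite // unity_rootE wn1.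
have sum0 : \sum_(i < n) w ^+ i = 0.
  by apply: (mulfI w1'); rewrite mulr0 -opprB mulNr -subrX1 wn1 subrr oppr0.
(* The powers of [w] sum to [0], and [1 - w] divides each [1 - w ^+ i]. *)
have -> : n%:R = \sum_(i < n) (1 - w ^+ i).
  by rewrite sumrB sum0 subr0 sumr_const card_ord.
rewrite mulr_suml rpred_sum // => i _.
have -> : 1 - w ^+ i = (1 - w) * \sum_(j < i) w ^+ j.
  by rewrite -opprB subrX1 -mulNr opprB.
by rewrite mulrAC divff // mul1r rpred_sum // => j _; rewrite rpredX.
Qed.

Lemma Aint_unity_inv (n : nat) (w : algC) : (0 < n)%N -> w ^+ n = 1 -> w^-1 \in Aint.
Proof.
by move=> n_gt0 wn1; apply: (@Aint_unity_root n); rewrite // unity_rootE exprVn wn1 invr1.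
Qed.

Section CompositeXnRoots.

Variables (p k N : nat).
Hypotheses (p_pr : prime p) (N_gt0 : (0 < N)%N).

Let T : {poly int} := 'Phi_(p ^ k.+1) \Po ('X^N + 1).

Let T_monic : T \is monic. Proof. exact: Cyclotomic_compXn_monic. Qed.

Lemma Cyclotomic_compXn_root (theta : algC) :
  root (map_poly intr T) theta = (p ^ k.+1).-primitive_root (theta ^+ N + 1).
Proof.
have pk_gt0 : (0 < p ^ k.+1)%N by rewrite expn_gt0 prime_gt0.
have [z z_prim] := C_prim_root_exists pk_gt0.
rewrite map_comp_poly /root horner_comp -(root_cyclotomic z_prim) -Cintr_Cyclotomic //.
by rewrite rmorphD rmorph1 /= map_polyXn !hornerE.
Qed.

(** If [x ^+ N = y ^+ N], then [x - y = x * (1 - y / x)], where [x] divides [p] and the second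
    factor divides [N]. Otherwise [x - y] divides [x ^+ N - y ^+ N], a difference of distinct
    [p ^ k.+1]-th roots of unity, which divides [p ^ k.+1]. The exponent [k.+2] covers both
    cases. *)
Lemma Cyclotomic_compXn_root_diff (x y : algC) :
    root (map_poly intr T) x -> root (map_poly intr T) y -> x != y ->
  (p ^ k.+2 * N)%:R / (x - y) \in Aint.
Proof.
move=> Tx Ty xy; have [U DT] := Cyclotomic_compXn_Eisenstein k N p_pr.
have Ax := Aint_root_int T_monic Tx; have Ay := Aint_root_int T_monic Ty.
have xy_neq0 : x - y != 0 by rewrite subr_eq0.
have [eqN|neqN] := eqVneq (x ^+ N) (y ^+ N).
  have [w Rw Dp] : exists2 w, int_adjoin x w & p%:R = x * w.
    apply: (@Eisenstein_root_dvd_prime p (totient (p ^ k.+1) * N) U) => //; rewrite -DT //.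
    exact: Cyclotomic_compXn_at0.
  have x_neq0 : x != 0.
    have p_neq0 : p%:R != 0 :> algC by rewrite pnatr_eq0 -lt0n prime_gt0.
    by apply: contraNneq p_neq0 => x0; rewrite Dp x0 mul0r.
  have -> : (p ^ k.+2 * N)%:R / (x - y) = (p ^ k.+1)%:R * w * (N%:R / (1 - y / x)).
    rewrite expnSr !natrM Dp -[y in LHS](divfK x_neq0) -[X in X - _]mul1r -mulrBl.
    by rewrite invfM; field; rewrite ?x_neq0 //=.
  apply: rpredM; first by rewrite rpredM ?rpred_nat //; apply: int_adjoin_Aint Rw.
  apply: Aint_nat_div_1Bunity; first by rewrite expr_div_n eqN divff // -eqN expf_neq0.
  by apply: contra_neq xy => /(canRL (divfK x_neq0))->; rewrite mul1r.
have xyN_neq0 : x ^+ N - y ^+ N != 0 by rewrite subr_eq0.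
rewrite !Cyclotomic_compXn_root in Tx Ty.
have pk_gt0 : (0 < p ^ k.+1)%N by rewrite expn_gt0 prime_gt0.
set a := x ^+ N + 1 in Tx *; set b := y ^+ N + 1 in Ty *.
have Dab : x ^+ N - y ^+ N = a - b by rewrite /a /b; ring.
have a_neq0 : a != 0 by rewrite (prim_root_eq0 Tx) -lt0n.
have := subrXX x y N; rewrite Dab; set S := \sum_(_ < _) _ => DS.
have S_neq0 : S != 0 by apply: contraNneq xyN_neq0 => S0; rewrite Dab DS S0 mulr0.
have -> : (p ^ k.+2 * N)%:R / (x - y) =
    (p * N)%:R * a^-1 * S * ((p ^ k.+1)%:R / (1 - b / a)).
  have ab_neq0 : a - b != 0 by rewrite -Dab.
  have -> : (x - y)^-1 = S / (a - b) by rewrite DS invfM mulrCA divff // mulr1.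
  rewrite expnS !natrM; field; rewrite ?a_neq0 ?ab_neq0 //.
apply: rpredM; first apply: rpredM; first apply: rpredM; first exact: rpred_nat.
- exact: Aint_unity_inv pk_gt0 (prim_expr_order Tx).
- by apply: rpred_sum => i _; rewrite rpredM ?rpredX.
apply: Aint_nat_div_1Bunity; first by rewrite expr_div_n !prim_expr_order // divff ?oner_eq0.
apply: contra_neq xyN_neq0 => /(canRL (divfK a_neq0)); rewrite mul1r Dab => ->.
by rewrite subrr.
Qed.

End CompositeXnRoots.

(** * Removing [p] from the denominators *)

Section CompositeXnDescent.

Variables (p k N : nat) (theta : algC).
Hypotheses (p_pr : prime p) (N_gt0 : (0 < N)%N).

Let T : {poly int} := 'Phi_(p ^ k.+1) \Po ('X^N + 1).

Hypothesis T_theta : root (map_poly intr T) theta.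

Let T_monic : T \is monic. Proof. exact: Cyclotomic_compXn_monic. Qed.

Lemma Cyclotomic_compXn_descent (x : algC) (a : nat) :
  x \in Aint -> int_adjoin theta ((p ^ a)%:R * x) -> int_adjoin theta x.
Proof.
have [U DT] := Cyclotomic_compXn_Eisenstein k N p_pr.
apply: (@Eisenstein_descent p (totient (p ^ k.+1) * N) U) => //; rewrite -?DT //.
  by rewrite muln_gt0 totient_gt0 expn_gt0 prime_gt0.
exact: Cyclotomic_compXn_at0.
Qed.

Lemma ring_of_integers_Cyclotomic_compXn (x : algC) :
    ring_of_integers (rat_adjoin theta) x ->
  exists n, int_adjoin theta ((N ^ n)%:R * x).
Proof.
move=> Ox; have Ax : x \in Aint by case: Ox.
have [n] : exists n, int_adjoin theta (((p ^ k.+2 * N) ^ n)%:R * x).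
  apply: (@ring_of_integers_denominator T) Ox => //.
    exact: Cyclotomic_compXn_irreducible.
  by move=> y z; apply: Cyclotomic_compXn_root_diff.
rewrite expnMn -expnM natrM -mulrA => Rx; exists n.
by apply: Cyclotomic_compXn_descent Rx; rewrite rpredM ?rpred_nat.
Qed.

End CompositeXnDescent.

Lemma int_adjoin_rat_adjoin_div (theta x : algC) (n : nat) : (0 < n)%N ->
  int_adjoin theta (n%:R * x) -> rat_adjoin theta x.
Proof.
rewrite lt0n => n_neq0 [g Dg]; exists (map_poly intr g), n%:R.
rewrite rmorph_nat -polyC_natr hornerC pnatr_eq0 n_neq0; split=> //.
rewrite -map_poly_comp (eq_map_poly (g := intr)) => [|a]; last by rewrite /= ratr_int.
by rewrite -Dg mulrC mulKf // pnatr_eq0.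
Qed.

(** * Preparations for the descent at 2: [Z[zeta]] and Frobenius *)

(** This is the case [N = 1]: [z - 1] is a root of [T], generates the same ring as [z], and the
    leftover denominator [N ^ n] is 1. The hypothesis on [2%:R * x] places [x] in the field. *)
Lemma Aint_half_int_adjoin_prim_root (p k : nat) (z x : algC) :
    prime p -> (p ^ k.+1).-primitive_root z -> x \in Aint ->
  int_adjoin z (2%:R * x) -> int_adjoin z x.
Proof.
move=> p_pr z_prim Ax Rx.
have adjz : int_adjoin (z - 1) z.
  by rewrite -[X in int_adjoin _ X](subrK 1); apply: int_adjoinD;
     [apply: int_adjoin_gen | apply: (int_adjoin_nat _ 1)].
have z1adj : int_adjoin z (z - 1).
  by apply: int_adjoinB; [apply: int_adjoin_gen | apply: (int_adjoin_nat _ 1)].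
have T_z1 : root (map_poly intr ('Phi_(p ^ k.+1) \Po ('X^1 + 1))) (z - 1).
  by rewrite Cyclotomic_compXn_root ?expr1 ?subrK.
have [|n] := ring_of_integers_Cyclotomic_compXn p_pr (ltn0Sn 0) T_z1 (x := x).
  split=> //; apply: (@int_adjoin_rat_adjoin_div _ _ 2) => //.
  exact: int_adjoin_trans adjz Rx.
by rewrite exp1n mul1r; apply: int_adjoin_trans.
Qed.

Lemma int_adjoin_exprD_pow2 (t a b : algC) (i : nat) :
    int_adjoin t a -> int_adjoin t b ->
  exists2 c, int_adjoin t c &
    (a + b) ^+ (2 ^ i) = a ^+ (2 ^ i) + b ^+ (2 ^ i) + 2%:R * c.
Proof.
move=> Ra Rb; elim: i => [|i [c Rc Dc]].
  exists 0; first exact: (int_adjoin_nat _ 0).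
  by rewrite expn0 !expr1 mulr0 addr0.
set A := a ^+ (2 ^ i) in Dc; set B := b ^+ (2 ^ i) in Dc.
have RA : int_adjoin t A by apply: int_adjoinX.
have RB : int_adjoin t B by apply: int_adjoinX.
exists (A * B + 2%:R * c * (A + B + c)).
  have R2 := int_adjoin_nat t 2.
  by do !first [assumption | apply: int_adjoinD | apply: int_adjoinM].
rewrite expnSr !exprM -/A -/B Dc; ring.
Qed.

(** Precision modulo 4 is needed because the term [2%:R * a ^+ (2 ^ j)] provides the Eisenstein
    constant term at 2. Squaring the formula preserves its shape. *)
Lemma int_adjoin_exprB1_pow2 (t a : algC) (j : nat) : int_adjoin t a ->
  exists2 c, int_adjoin t c &
    (a - 1) ^+ (2 ^ j.+1) = a ^+ (2 ^ j.+1) + 1 + 2%:R * a ^+ (2 ^ j) + 4%:R * c.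
Proof.
move=> Ra; elim: j => [|j [c Rc Dc]].
  exists (- a); first exact: int_adjoinN.
  by rewrite expn0 expn1 expr1; ring.
set A := a ^+ (2 ^ j) in Dc; have RA : int_adjoin t A by apply: int_adjoinX.
have DA2 : a ^+ (2 ^ j.+1) = A ^+ 2 by rewrite expnSr exprM.
have DA4 : a ^+ (2 ^ j.+2) = A ^+ 4 by rewrite !expnSr -mulnA exprM.
have R1 := int_adjoin_nat t 1; have R2 := int_adjoin_nat t 2.
exists ((A + 2%:R * c) * (A * A + 1) + (A + 2%:R * c) * (A + 2%:R * c)).
  by do !first [assumption | apply: int_adjoinD | apply: int_adjoinM].
by rewrite DA4 [in LHS]expnSr exprM Dc DA2; ring.
Qed.

Lemma intr_exp_pow2 (c : int) (i : nat) :
  exists b : int, c ^+ (2 ^ i) = c + 2%:R * b.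
Proof.
have : (2 %| c ^+ (2 ^ i) - c)%Z.
  rewrite (dvdz_pcharf (pchar_Fp (isT : prime 2))) rmorphB rmorphXn subr_eq0 /=.
  have /orP[/eqP->|/eqP->] : (c%:~R == 0 :> 'F_2) || (c%:~R == 1 :> 'F_2).
  - by case: (c%:~R) => [[|[|]]].
  - by rewrite expr0n expn_eq0.
  by rewrite expr1n.
case/dvdzP=> b Db; exists b; rewrite mulrC -[2%:R]/(2 : int) -Db; ring.
Qed.

(** Modulo 2 the map is additive and multiplicative, fixes integers, and fixes [z] by hypothesis,
    hence fixes every polynomial in [z]. *)
Lemma int_adjoin_Frobenius2 (z a : algC) (i : nat) :
    z ^+ (2 ^ i) = z -> int_adjoin z a ->
  exists2 c, int_adjoin z c & a ^+ (2 ^ i) = a + 2%:R * c.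
Proof.
move=> zi [g ->]; have Rz := int_adjoin_gen z.
elim/poly_ind: g => [|g c [d Rd Dd]].
  exists 0; first exact: (int_adjoin_nat _ 0).
  by rewrite rmorph0 horner0 mulr0 addr0 expr0n expn_eq0.
rewrite rmorphD rmorphM /= map_polyX map_polyC hornerMXaddC.
set G := (map_poly intr g).[z] in Dd *.
have RG : int_adjoin z G by exists g.
have [e Re ->] := int_adjoin_exprD_pow2 i (int_adjoinM RG Rz) (int_adjoin_int z c).
rewrite exprMn zi Dd -rmorphXn; have [b ->] := intr_exp_pow2 c i.
exists (d * z + b%:~R + e).
  have Rb := int_adjoin_int z b.
  by do !first [assumption | apply: int_adjoinD | apply: int_adjoinM].
rewrite rmorphD rmorphM /=; ring.
Qed.

(** * Descent at 2 for odd [p] *)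

Section DescentTwo.

Variables (p k j : nat) (theta : algC).
Hypotheses (p_pr : prime p) (p_odd : odd p).

Let q := (p ^ k.+1)%N.
Let N := (2 ^ j.+1)%N.
Hypothesis T_theta : root (map_poly intr ('Phi_(p ^ k.+1) \Po ('X^N + 1))) theta.

Let N_gt0 : (0 < N)%N. Proof. by rewrite expn_gt0. Qed.
Let theta_Aint : theta \in Aint.
Proof. by apply: Aint_root_int T_theta; apply: Cyclotomic_compXn_monic. Qed.
Let zeta := theta ^+ N + 1.
Let zeta_prim : q.-primitive_root zeta.
Proof. by rewrite -Cyclotomic_compXn_root. Qed.

Let q_odd : odd q. Proof. by rewrite oddX p_odd orbT. Qed.
Let q_gt1 : (1 < q)%N. Proof. by rewrite -(exp1n k.+1) ltn_exp2r ?prime_gt1. Qed.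

(** The factor [totient q] gives [2 ^ m = 1] modulo [q], so that [zeta ^+ (2 ^ m) = zeta]; the
    factor [j.+1] ensures that [N] divides [2 ^ m], with quotient [e]. *)
Let m := (totient q * j.+1)%N.
Let e := (2 ^ (m - j.+1))%N.

Let De : (e * N)%N = (2 ^ m)%N.
Proof.
by rewrite /e /N -expnD subnK // leq_pmull // totient_gt0 ltnW.
Qed.

Let zeta_exp2m : zeta ^+ (2 ^ m) = zeta.
Proof.
rewrite -[RHS]expr1; apply/eqP; rewrite (eq_prim_root_expr zeta_prim) /m expnM.
by rewrite -modnXm Euler_exp_totient ?coprime2n // modnXm exp1n.
Qed.

Let eta := zeta ^+ e.
Let eta_expN : eta ^+ N = zeta. Proof. by rewrite /eta -exprM De. Qed.
Let thetaN : theta ^+ N = eta ^+ N - 1. Proof. by rewrite eta_expN addrK. Qed.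

Let pi := theta - (eta - 1).

Let Rzeta : int_adjoin theta zeta.
Proof.
by apply: int_adjoinD (int_adjoin_nat _ 1); apply/int_adjoinX/int_adjoin_gen.
Qed.
Let A_eta : int_adjoin zeta eta. Proof. exact/int_adjoinX/int_adjoin_gen. Qed.
Let R_A (x : algC) : int_adjoin zeta x -> int_adjoin theta x.
Proof. exact: int_adjoin_trans. Qed.
Let A_eta1 : int_adjoin zeta (eta - 1).
Proof. exact: int_adjoinB A_eta (int_adjoin_nat _ 1). Qed.
Let Rpi : int_adjoin theta pi.
Proof. by apply: int_adjoinB; [apply: int_adjoin_gen | apply: R_A]. Qed.

Let zeta_Aint : zeta \in Aint. Proof. exact: Aint_prim_root zeta_prim. Qed.


(* [Z[zeta] / 2] is reduced, because Frobenius has finite order on it. *)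
Let reduced_mod2 (a : algC) :
    int_adjoin zeta a -> (exists2 b, int_adjoin zeta b & a ^+ N = 2%:R * b) ->
  exists2 b, int_adjoin zeta b & a = 2%:R * b.
Proof.
move=> Aa [b Ab Db]; have [c Ac] := int_adjoin_Frobenius2 zeta_exp2m Aa.
(* Frobenius makes [a ^+ (2 ^ m) = (2%:R * b) ^+ e] congruent to [a], and [0 < e] lets a factor 2 be
   split off. *)
rewrite -De mulnC exprM Db; have : (0 < e)%N by rewrite expn_gt0.
case: (e) => // e' _ Dc; exists (b * (2%:R * b) ^+ e' - c).
  apply: int_adjoinB => //; apply: int_adjoinM => //; apply/int_adjoinX/int_adjoinM => //.
  exact: (int_adjoin_nat _ 2).
by rewrite mulrBr mulrA -exprS Dc addrK.
Qed.

(** Modulo 2, [pi ^+ N] is [theta ^+ N + (1 - eta) ^+ N], that is [(eta ^+ N - 1) + (1 + eta ^+ N)],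
    which vanishes. *)
Let pi_expN : exists2 v, int_adjoin theta v & pi ^+ N = 2%:R * v.
Proof.
have R1eta : int_adjoin theta (- (eta - 1)) by apply/int_adjoinN/R_A.
have [c Rc ->] := int_adjoin_exprD_pow2 j.+1 (int_adjoin_gen theta) R1eta.
rewrite -/N thetaN opprB.
have [d Rd ->] := int_adjoin_exprD_pow2 j.+1 (int_adjoin_nat theta 1) (int_adjoinN (R_A A_eta)).
rewrite -/N expr1n exprNn -signr_odd oddX orbF expr0 mul1r.
exists (eta ^+ N + d + c); last ring.
by do 2!apply: int_adjoinD => //; apply/int_adjoinX/R_A.
Qed.

Let omega := eta ^+ (2 ^ j).

(* [omega ^+ 2 = zeta] and [q] is odd, so
   [1 - omega = 1 - (omega ^+ 2) ^+ (q.+1)./2] is a multiple of [1 - omega ^+ 2]. *)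
Let unit_1Domega : exists2 w, int_adjoin zeta w & (1 + omega) * w = 1.
Proof.
have omega2 : omega ^+ 2 = zeta by rewrite /omega -exprM -expnSr eta_expN.
have omegaq : omega ^+ q = 1.
  by rewrite /omega /eta -!exprM mulnA mulnC exprM (prim_expr_order zeta_prim) expr1n.
exists (\sum_(i < (q.+1)./2) (omega ^+ 2) ^+ i).
  apply: big_ind => [|x y Ax Ay|i _]; first exact: (int_adjoin_nat _ 0).
    exact: int_adjoinD.
  by do 3!apply: int_adjoinX.
have omega_neq1 : 1 - omega != 0.
  rewrite subr_eq0 eq_sym; apply/eqP=> omega1.
  have := eq_prim_root_expr zeta_prim 1 0.
  by rewrite expr1 -omega2 omega1 expr1n eqxx mod0n modn_small.
apply: (mulfI omega_neq1); rewrite mulrA mulr1.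
have -> : (1 - omega) * (1 + omega) = - (omega ^+ 2 - 1) by ring.
rewrite mulNr -subrX1 -exprM mul2n halfK /= q_odd subn0 exprS omegaq mulr1; ring.
Qed.

(** Modulo [pi], [theta] is [eta - 1], so [pi] divides [(eta - 1) ^+ N - (eta ^+ N - 1) = 2 * (1 +
    omega) + 4 * c]. Multiplying by the inverse of [1 + omega] gives 2 times a factor invertible
    modulo 2. *)
Let pi_dvd_2 : exists2 s, int_adjoin zeta s &
  exists2 r, int_adjoin theta r & 2%:R * (1 + 2%:R * s) = pi * r.
Proof.
have [c Ac Dc] := int_adjoin_exprB1_pow2 j A_eta.
have [w Aw Dw] := unit_1Domega.
have [r Rr Dr] := int_adjoin_hornerB 'X^N (R_A A_eta1).
exists (c * w); first exact: int_adjoinM.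
exists (- r * w); first by apply: int_adjoinM (R_A Aw); apply: int_adjoinN.
move: Dr; rewrite map_polyXn !hornerXn thetaN Dc -/N -/omega -/pi => Dr.
have -> : pi * (- r * w) = (2%:R * (1 + omega) + 4%:R * c) * w.
  have -> : pi * (- r * w) = - (pi * r) * w by ring.
  by congr (_ * w); rewrite -[pi * r](addKr (eta ^+ N + 1 + 2%:R * omega + 4%:R * c)) -Dr; ring.
rewrite -[X in X + 2%:R * (c * w)]Dw; ring.
Qed.

Let pi_neq0 : pi != 0.
Proof.
have [s As [r Rr Ds]] := pi_dvd_2; apply/eqP=> pi0.
(* If [pi] were 0, then [1 + 2%:R * s = 0] would make one half an algebraic integer. *)
have := @dvdz_Aint 2 1 isT; rewrite mul1r => H.
suff : (2%:~R^-1 : algC) \in Aint by move/H.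
have -> : (2%:~R^-1 : algC) = - s.
  apply: (mulfI (_ : 2%:R != 0)); rewrite ?pnatr_eq0 // divff ?pnatr_eq0 //.
  apply/eqP; rewrite mulrN -addr_eq0; move/eqP: Ds.
  by rewrite pi0 mul0r mulf_eq0 pnatr_eq0.
by rewrite rpredN; apply: int_adjoin_Aint As.
Qed.

(** Modulo [pi], [pi * y] reduces to some [a] in [Z[zeta]] that [pi] divides. Then [a ^+ N] is
    divisible by 2 in [Z[zeta]], hence so is [a], and [pi_dvd_2] allows [pi] to be cancelled up to
    the factor [1 + 2%:R * s]. *)
Let descent_pi1 (y : algC) :
    y \in Aint -> int_adjoin theta (2%:R * y) -> int_adjoin theta (pi * y) ->
  int_adjoin theta y.
Proof.
move=> Ay R2y [g Dg]; have [r Rr] := int_adjoin_hornerB g (R_A A_eta1).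
rewrite -Dg -/pi; set a := (_).[_] => Dy.
have Aa : int_adjoin zeta a by apply: int_adjoin_trans A_eta1 _; exists g.
have Da : a = pi * (y - r) by rewrite mulrBr Dy addrK.
have Ayr : y - r \in Aint by rewrite rpredB //; apply: int_adjoin_Aint Rr.
have [v Rv Dv] := pi_expN.
have [|a' Aa' Da'] := reduced_mod2 Aa.
  exists (v * (y - r) ^+ N); last by rewrite Da exprMn Dv mulrA.
  apply: (Aint_half_int_adjoin_prim_root p_pr zeta_prim).
    by rewrite rpredM ?rpredX //; apply: int_adjoin_Aint Rv.
  by rewrite mulrA -Dv -exprMn -Da; apply: int_adjoinX.
have [s As [r0 Rr0 Dr0]] := pi_dvd_2.
(* The factor [1 + 2%:R * s] is absorbed because [2%:R * y] already lies in [Z[theta]]. *)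
have -> : y = r * (1 + 2%:R * s) + r0 * a' - s * (2%:R * y).
  suff Ds : (1 + 2%:R * s) * (y - r) = r0 * a'.
    by rewrite -Ds; ring.
  apply: (mulfI pi_neq0); rewrite mulrCA -Da Da' [RHS]mulrA -Dr0; ring.
have R2 := int_adjoin_nat theta 2; have R1 := int_adjoin_nat theta 1.
have Rs := R_A As; have Ra' := R_A Aa'.
by apply: int_adjoinB; do !first [assumption | apply: int_adjoinD | apply: int_adjoinM].
Qed.

Lemma Cyclotomic_compX2n_descent2 (x : algC) (a : nat) :
  x \in Aint -> int_adjoin theta ((2 ^ a)%:R * x) -> int_adjoin theta x.
Proof.
have pi_Aint : pi \in Aint by apply: int_adjoin_Aint Rpi.
have R2 := int_adjoin_nat theta 2.
have descent_exp i y : y \in Aint -> int_adjoin theta (2%:R * y) ->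
    int_adjoin theta (pi ^+ i * y) -> int_adjoin theta y.
  move=> Ay R2y; elim: i => [|i IHi]; first by rewrite mul1r.
  rewrite exprS -mulrA => /descent_pi1 Ry; apply/IHi/Ry.
    by rewrite rpredM ?rpredX.
  by rewrite mulrCA; apply/int_adjoinM/R2y/int_adjoinX.
move=> Ax; elim: a => [|a IHa]; first by rewrite mul1r.
rewrite expnS natrM -mulrA; set y := _ * x => Ry; apply/IHa/(descent_exp N) => //.
  by rewrite rpredM ?rpred_nat.
have [v Rv ->] := pi_expN.
by rewrite mulrAC mulrC; apply: int_adjoinM.
Qed.

End DescentTwo.

(** * Assembly of the two descents *)

Theorem theorem1p1 (m n p : nat) (hm : (0 < m)%N) (hn : (0 < n)%N)
    (hp : prime p) :
  let T : {poly int} := 'Phi_(p ^ m) \Po 'Phi_(2 ^ n) in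
  irreducible_over_rat T /\ monogenic T.
Proof.
case: m hm => // k _; case: n hn => // j _ T.
have DT : T = 'Phi_(p ^ k.+1) \Po ('X^(2 ^ j) + 1) by rewrite /T Cyclotomic_pow2.
have N_gt0 : (0 < 2 ^ j)%N by rewrite expn_gt0.
have T_irr : irreducible_over_rat T by rewrite DT; apply: Cyclotomic_compXn_irreducible.
have T_monic : T \is monic by rewrite DT; apply: Cyclotomic_compXn_monic.
split=> //; split=> // theta T_theta.
have theta_Aint := Aint_root_int T_monic T_theta.
have int_adjoin_integers x : ring_of_integers (rat_adjoin theta) x -> int_adjoin theta x.
  move: T_theta; rewrite DT => T_theta Ox; have [_ Ax] := Ox.
  have [i] := ring_of_integers_Cyclotomic_compXn hp N_gt0 T_theta Ox.
  (* The remaining denominator is [2 ^ (j * i)]: for [p = 2] the Eisenstein descent removes it, and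
     for odd [p] the descent at 2 does unless [j = 0], where it is already 1. *)
  rewrite -expnM => Rx; have [p2|p_odd] := even_prime hp.
    by apply: (Cyclotomic_compXn_descent hp N_gt0 T_theta Ax (a := j * i)); rewrite p2.
  case: j T_theta Rx {T DT N_gt0 T_irr T_monic} => [|j] T_theta Rx; first by rewrite mul1r in Rx.
  exact: (Cyclotomic_compX2n_descent2 hp p_odd T_theta Ax Rx).
split=> [x Rx|].
  split; last exact: int_adjoin_Aint Rx.
  by apply: (@int_adjoin_rat_adjoin_div _ _ 1) => //; rewrite mul1r.
(* Index 1 means a single coset, represented by 0. *)
exists (fun=> 0); split=> [_|x /int_adjoin_integers Rx].
  split; last exact: rpred0.
  by apply: (@int_adjoin_rat_adjoin_div _ _ 1) => //; rewrite mulr0; apply: (int_adjoin_nat _ 0).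
by exists ord0; rewrite subr0; split=> // i _; apply/esym/ord1.
Qed.
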